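(* Fix $\kappa\ge0$. Let $(A_0,B_0)\in\mathcal{D}$ with $X_2(A_0,B_0)=0$. Choose $(q(0),\xi(0))\in\mathbb{R}^3\times\mathbb{R}^3$ with $q_2(0)=\xi_2(0)$ such that $\Phi\circ\Gamma\circ\Psi_0(q(0),\xi(0))=(A_0,B_0)$. Let $(q,\xi)\in C^1(\mathbb{R},\mathbb{R}^3\times\mathbb{R}^3)$ be the global solution, with initial data $(q(0),\xi(0))$, of the system $$\begin{aligned}&\dot q_1=\frac{(2+q_1^2)\xi_1}{2(1+q_1^2)},&&\dot\xi_1=\left(\frac{\xi_1^2}{2(1+q_1^2)^2}+\frac{\xi_3^2}{(2+q_1^2)^2}-2\kappa\right)q_1,\\&\dot q_2=0,&&\dot\xi_2=0,\\&\dot q_3=\frac{\xi_3}{2+q_1^2},&&\dot\xi_3=0.\end{aligned}$$ Then $A(t)=\varphi\circ\psi\circ q(t)$, $t\in\mathbb{R}$, is the solution in $C^0(\mathbb{R},\mathrm{SL}(2,\mathbb{R}))\cap C^2(\mathbb{R},\mathbb{M}^2)$ of $$\ddot A(t)+\kappa A(t)=\lambda(t)\,\mathrm{cof}\,A(t)$$ with initial data $(A(0),\dot A(0))=(A_0,B_0)$. Explicitly, $$A(t)=\tfrac1{\sqrt2}\,U\!\left(\tfrac12(q_3(t)+q_2(0))\right)\left(\rho(t)I+q_1(t)K\right)U\!\left(\tfrac12(q_3(t)-q_2(0))\right),\qquad \rho(t)=(2+q_1(t)^2)^{1/2}.$$ There holds $\tfrac12|A(t)|^2=1+q_1(t)^2$,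 and the fluid domain $\Omega(t)=A(t)\mathcal{B}$ is an ellipse with principal semi-axes of lengths $$\tfrac1{\sqrt2}\left[\left(\tfrac12|A(t)|^2+1\right)^{1/2}\pm\left(\tfrac12|A(t)|^2-1\right)^{1/2}\right].$$
   Context: $\mathbb{M}^2$ is the space of real $2\times2$ matrices with inner product $\langle A,B\rangle=\mathrm{tr}(A^\top B)$ and norm $|A|=\langle A,A\rangle^{1/2}$. $\mathrm{SL}(2,\mathbb{R})=\{\det A=1\}$. $I=\begin{bmatrix}1&0\\0&1\end{bmatrix}$, $Z=\begin{bmatrix}0&-1\\1&0\end{bmatrix}$, $K=\begin{bmatrix}1&0\\0&-1\end{bmatrix}$, $M=\begin{bmatrix}0&1\\1&0\end{bmatrix}$; $U(\theta)=\cos\theta\,I+\sin\theta\,Z$; $\mathrm{cof}\,A=ZAZ^\top$ is the cofactor matrix. $\mathcal{D}=\{(A,B):\det A=1,\ \langle B,\mathrm{cof}\,A\rangle=0\}$ is the tangent bundle of $\mathrm{SL}(2,\mathbb{R})$. $X_2(A,B)=\tfrac12\langle ZA-AZ,B\rangle$. $\mathcal{B}\subset\mathbb{R}^2$ is the closed unit disk. A solution of $\ddot A+\kappa A=\lambda\,\mathrm{cof}\,A$ means that the equation holds for some $\lambda\in C^0(\mathbb{R},\mathbb{R})$; for an $\mathrm{SL}(2,\mathbb{R})$-valued solution necessarily $\lambda(t)=2(\kappa-\det\dot A(t))/|A(t)|^2$, and the solution with given initial data in $\mathcal{D}$ exists and is unique. For $x\in\mathbb{R}^3$: $\varphi(x)=\tfrac1{\sqrt2}\big((2+x_1^2+x_2^2)^{1/2}(\cos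 x_3\,I+\sin x_3\,Z)+x_1K+x_2M\big)$ and $g(x)=D_x\varphi(x)^\top D_x\varphi(x)$ (an invertible $3\times3$ matrix). $\Phi(x,y)=(\varphi(x),D_x\varphi(x)y)$, $\Gamma(x,p)=(x,g^{-1}(x)p)$. $\psi(q)=(q_1\cos q_2,\,q_1\sin q_2,\,q_3)$ and $\Psi_0(q,\xi)=(\psi(q),\psi(\xi))$ for $q,\xi\in\mathbb{R}^3$. Every $(A,B)\in\mathcal{D}$ with $X_2(A,B)=0$ equals $\Phi\circ\Gamma\circ\Psi_0(q,\xi)$ for some $(q,\xi)$ with $q_2=\xi_2$. *)

(* Defs.v *)
From HB Require Import structures.
From mathcomp Require Import all_boot all_order all_algebra.
From mathcomp Require Import all_classical all_reals all_analysis.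

Set Implicit Arguments.
Unset Strict Implicit.
Unset Printing Implicit Defensive.

Import Order.TTheory GRing.Theory Num.Theory.
Import numFieldNormedType.Exports.

Local Open Scope ring_scope.
Local Open Scope classical_set_scope.

Definition vec3 (R : realType) (a b c : R) : 'cV[R]_3 :=
  \col_(i < 3) [:: a; b; c]`_i.

Definition mat2 (R : realType) (a b c d : R) : 'M[R]_2 :=
  \matrix_(i < 2, j < 2) (nth [::] [:: [:: a; b]; [:: c; d]] i)`_j.

Definition x1 (R : realType) (v : 'cV[R]_3) : R := v 0 0.
Definition x2 (R : realType) (v : 'cV[R]_3) : R := v 1 0.
Definition x3 (R : realType) (v : 'cV[R]_3) : R := v 2 0.

Definition inner (R : realType) (A B : 'M[R]_2) : R := \tr (A^T *m B).

(* Not the library norm `|A| on matrices, which is the sup norm. *)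
Definition mnorm (R : realType) (A : 'M[R]_2) : R := Num.sqrt (inner A A).

Definition SL2 (R : realType) : set 'M[R]_2 := [set A | \det A = 1].

Definition matZ (R : realType) : 'M[R]_2 := mat2 0 (-1) 1 0.
Definition matK (R : realType) : 'M[R]_2 := mat2 1 0 0 (-1).
Definition matM (R : realType) : 'M[R]_2 := mat2 0 1 1 0.
Arguments matZ {R}.
Arguments matK {R}.
Arguments matM {R}.

Definition U (R : realType) (theta : R) : 'M[R]_2 :=
  cos theta *: 1%:M + sin theta *: matZ.

Definition cof (R : realType) (A : 'M[R]_2) : 'M[R]_2 := matZ *m A *m matZ^T.

Definition tangent_bundle (R : realType) : set ('M[R]_2 * 'M[R]_2) :=
  [set AB | \det AB.1 = 1 /\ inner AB.2 (cof AB.1) = 0].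

Definition X2 (R : realType) (A B : 'M[R]_2) : R :=
  2^-1 * inner (matZ *m A - A *m matZ) B.

Definition phi (R : realType) (x : 'cV[R]_3) : 'M[R]_2 :=
  (Num.sqrt 2)^-1 *:
    (Num.sqrt (2 + x1 x ^+ 2 + x2 x ^+ 2) *:
       (cos (x3 x) *: 1%:M + sin (x3 x) *: matZ)
     + x1 x *: matK + x2 x *: matM).

Definition Dphi (R : realType) (x y : 'cV[R]_3) : 'M[R]_2 :=
  'd (@phi R) x y.

(* Matrix of the differential of phi at x; mxvec identifies ('M_2, inner)
   isometrically with Euclidean 4-space, so that the matrix transpose below
   is the adjoint for inner. *)
Definition Dphi_mx (R : realType) (x : 'cV[R]_3) : 'M[R]_(2 * 2, 3) :=
  \matrix_(k, j) mxvec (Dphi x (delta_mx j 0)) 0 k.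

Definition g (R : realType) (x : 'cV[R]_3) : 'M[R]_3 :=
  (Dphi_mx x)^T *m Dphi_mx x.

Definition Phi (R : realType) (xy : 'cV[R]_3 * 'cV[R]_3) :
    'M[R]_2 * 'M[R]_2 :=
  (phi xy.1, Dphi xy.1 xy.2).

Definition Gamma (R : realType) (xp : 'cV[R]_3 * 'cV[R]_3) :
    'cV[R]_3 * 'cV[R]_3 :=
  (xp.1, invmx (g xp.1) *m xp.2).

Definition psi (R : realType) (q : 'cV[R]_3) : 'cV[R]_3 :=
  vec3 (x1 q * cos (x2 q)) (x1 q * sin (x2 q)) (x3 q).

Definition Psi0 (R : realType) (qxi : 'cV[R]_3 * 'cV[R]_3) :
    'cV[R]_3 * 'cV[R]_3 :=
  (psi qxi.1, psi qxi.2).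

Definition C1 (R : realType) (V : normedModType R) (f : R -> V) : Prop :=
  (forall t, derivable f t 1) /\ continuous (derive1 f).

Definition C2 (R : realType) (V : normedModType R) (f : R -> V) : Prop :=
  (forall t, derivable f t 1) /\ C1 (derive1 f).

Definition reduced_solution (R : realType) (kappa : R) (q xi : R -> 'cV[R]_3) :
    Prop :=
  [/\ C1 q, C1 xi,
      forall t, derive1 q t =
        vec3 ((2 + x1 (q t) ^+ 2) * x1 (xi t) / (2 * (1 + x1 (q t) ^+ 2)))
             0
             (x3 (xi t) / (2 + x1 (q t) ^+ 2))
    & forall t, derive1 xi t =
        vec3 ((x1 (xi t) ^+ 2 / (2 * (1 + x1 (q t) ^+ 2) ^+ 2)
               + x3 (xi t) ^+ 2 / (2 + x1 (q t) ^+ 2) ^+ 2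
               - 2 * kappa) * x1 (q t))
             0
             0].

Definition SL2_solution (R : realType) (kappa : R) (A0 B0 : 'M[R]_2)
    (A : R -> 'M[R]_2) : Prop :=
  [/\ continuous A /\ (forall t, SL2 (A t)),
      C2 A,
      exists lambda : R -> R, continuous lambda /\
        forall t, derive1 (derive1 A) t + kappa *: A t = lambda t *: cof (A t),
      A 0 = A0
    & derive1 A 0 = B0].

Definition unit_disk (R : realType) : set 'cV[R]_2 :=
  [set v | (v^T *m v) 0 0 <= 1].

Definition fluid_domain (R : realType) (A : 'M[R]_2) : set 'cV[R]_2 :=
  [set A *m v | v in @unit_disk R].

(* A filled ellipse with center c and principal axes along the orthonormal
   vectors e1 and e2, with semi-axes of lengths a and b respectively. *)
Definition is_ellipse (R : realType) (S : set 'cV[R]_2) (a b : R) : Prop :=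
  0 < a /\ 0 < b /\
  exists c e1 e2 : 'cV[R]_2,
    [/\ (e1^T *m e1) 0 0 = 1, (e2^T *m e2) 0 0 = 1, (e1^T *m e2) 0 0 = 0
      & S = [set v | exists x y : R,
               (x / a) ^+ 2 + (y / b) ^+ 2 <= 1 /\
               v = c + x *: e1 + y *: e2]].

(* Main.v *)
Require Import Defs.
From HB Require Import structures.
From mathcomp Require Import all_boot all_order all_algebra.
From mathcomp Require Import all_classical all_reals all_analysis.
From mathcomp Require Import ring lra.

Set Implicit Arguments.
Unset Strict Implicit.
Unset Printing Implicit Defensive.

Import Order.TTheory GRing.Theory Num.Theory.
Import numFieldNormedType.Exports.

Local Open Scope classical_set_scope.
Local Open Scope ring_scope.

(** In the coordinates of the orthogonal basis [I], [Z], [K], [M] of matrices,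
    [cof] is the identity on the span of [I, Z] and minus the identity on the
    span of [K, M].  With [q2] constant, the curve [phi (psi (q t))] is
    [(rho cos q3 I + rho sin q3 Z + q1 (cos q2 K + sin q2 M)) / sqrt 2], so the
    equation of motion splits into three scalar ones.  The one along [Z U(q3)]
    says that [xi3 = rho ^ 2 q3'] is conserved; the one in the [K, M] plane
    defines the multiplier, namely
    [lambda = (q1' ^ 2 - xi3 ^ 2 / 2) / ((2 + q1 ^ 2) (1 + q1 ^ 2))
              + kappa / (1 + q1 ^ 2)];
    and the one along [U(q3)] then holds identically because
    [rho ^ 2 = 2 + q1 ^ 2] ([is_derive_radial_speed]).  The determinant is
    [(rho ^ 2 - q1 ^ 2) / 2 = 1].

    For the initial velocity one needs [g (x) x' = psi xi] along the curve.  The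
    metric is explicit ([mul_g]): the identity plus the rank one term
    [x x^T / rho ^ 2] in the first two coordinates, and [rho ^ 2] in the third;
    in particular it is invertible ([g_unit]), and inverting the Legendre
    transform gives the velocity prescribed by the reduced system
    ([Dphi_invmx_g]).

    For uniqueness, differentiating [det A = 1] twice along any solution gives
    [lambda |A| ^ 2 = 2 kappa - <A', cof A'>] ([multiplierE]), and
    [|A| ^ 2 >= 2 det A = 2].  Hence the difference of the multipliers of two
    solutions is bounded by the distance of the solutions in phase space, with a
    coefficient that is continuous in time, and the squared distance vanishes by
    Gronwall's inequality ([SL2_motion_unique], [gronwall]).

    Finally [A] is a rotation times a diagonal matrix times a rotation
    ([U_diag_U]), with diagonal entries [(rho + q1) / sqrt 2] and
    [(rho - q1) / sqrt 2].  The last rotation preserves the disk; the image of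
    the disk is thus an ellipse whose semi-axes are these entries; the sign of [q1]
    decides which one is the longer ([is_ellipse_motion]). *)

(** * Two by two matrices in coordinates *)

Section Algebra.
Variable R : realType.
Implicit Types (A B X Y : 'M[R]_2) (a b c d r p : R).

Lemma ord2P (P : 'I_2 -> Prop) : P 0 -> P 1 -> forall i, P i.
Proof.
move=> P0 P1 [[|[|//]] h].
- by rewrite (_ : Ordinal h = 0) //; apply/val_inj.
- by rewrite (_ : Ordinal h = 1) //; apply/val_inj.
Qed.

Lemma ord3P (P : 'I_3 -> Prop) : P 0 -> P 1 -> P 2 -> forall i, P i.
Proof.
move=> P0 P1 P2 [[|[|[|//]]] h].
- by rewrite (_ : Ordinal h = 0) //; apply/val_inj.
- by rewrite (_ : Ordinal h = 1) //; apply/val_inj.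
- by rewrite (_ : Ordinal h = 2) //; apply/val_inj.
Qed.

Lemma sum2E (V : nmodType) (F : 'I_2 -> V) : \sum_i F i = F 0 + F 1.
Proof.
rewrite big_ord_recl big_ord_recl big_ord0 addr0.
by congr (_ + F _); apply/val_inj.
Qed.

Lemma sum3E (V : nmodType) (F : 'I_3 -> V) : \sum_i F i = F 0 + F 1 + F 2.
Proof.
rewrite !big_ord_recl big_ord0 addr0 addrA.
by congr (_ + F _ + F _); apply/val_inj.
Qed.

Lemma eq_mat2 A B : A 0 0 = B 0 0 -> A 0 1 = B 0 1 -> A 1 0 = B 1 0 ->
  A 1 1 = B 1 1 -> A = B.
Proof. by move=> *; apply/matrixP; apply: ord2P; apply: ord2P. Qed.

Lemma mat2_eta A : A = mat2 (A 0 0) (A 0 1) (A 1 0) (A 1 1).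
Proof. by apply: eq_mat2; rewrite !mxE. Qed.

Lemma add_mat2 a b c d a' b' c' d' :
  mat2 a b c d + mat2 a' b' c' d' = mat2 (a + a') (b + b') (c + c') (d + d').
Proof. by apply: eq_mat2; rewrite !mxE. Qed.

Lemma scale_mat2 k a b c d :
  k *: mat2 a b c d = mat2 (k * a) (k * b) (k * c) (k * d).
Proof. by apply: eq_mat2; rewrite !mxE. Qed.

Lemma mul_mat2 a b c d a' b' c' d' :
  mat2 a b c d *m mat2 a' b' c' d' =
  mat2 (a * a' + b * c') (a * b' + b * d') (c * a' + d * c') (c * b' + d * d').
Proof. by apply: eq_mat2; rewrite !mxE sum2E !mxE. Qed.

Lemma tr_mat2 a b c d : (mat2 a b c d)^T = mat2 a c b d.
Proof. by apply: eq_mat2; rewrite !mxE. Qed.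

Lemma scalar_mat2 a : a%:M = mat2 a 0 0 a.
Proof. by apply: eq_mat2; rewrite !mxE. Qed.

Definition mat2E :=
  (scalar_mat2, tr_mat2, mul_mat2, scale_mat2, add_mat2).

(** The matrix [a I + b Z + c K + d M]; the four matrices are orthogonal for
    [inner], the first two being fixed by [cof] and the last two negated. *)
Definition izkm a b c d : 'M[R]_2 := mat2 (a + c) (d - b) (b + d) (a - c).

Lemma innerE A B : inner A B =
  A 0 0 * B 0 0 + A 0 1 * B 0 1 + A 1 0 * B 1 0 + A 1 1 * B 1 1.
Proof.
rewrite /inner [in LHS](mat2_eta A) [in LHS](mat2_eta B) !mat2E.
by rewrite /mxtrace sum2E !mxE /=; ring.
Qed.

Lemma cofE A : cof A = mat2 (A 1 1) (- A 1 0) (- A 0 1) (A 0 0).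
Proof.
rewrite /cof [in LHS](mat2_eta A) /matZ !mat2E.
by apply: eq_mat2; rewrite !mxE /=; ring.
Qed.

Lemma det2E A : \det A = A 0 0 * A 1 1 - A 0 1 * A 1 0.
Proof.
rewrite (expand_det_row A 0) sum2E /cofactor !det_mx11 !mxE /=.
have -> : lift 0 0 = 1 :> 'I_2 by apply/val_inj.
have -> : lift 1 0 = 0 :> 'I_2 by apply/val_inj.
by rewrite expr0 expr1; ring.
Qed.

Lemma det_izkm a b c d :
  \det (izkm a b c d) = a ^+ 2 + b ^+ 2 - c ^+ 2 - d ^+ 2.
Proof. by rewrite det2E !mxE /=; ring. Qed.

Lemma inner_izkm a b c d a' b' c' d' :
  inner (izkm a b c d) (izkm a' b' c' d') =
  2 * (a * a' + b * b' + c * c' + d * d').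
Proof. by rewrite innerE !mxE /=; ring. Qed.

Lemma cof_izkm a b c d : cof (izkm a b c d) = izkm a b (- c) (- d).
Proof. by rewrite cofE; apply: eq_mat2; rewrite !mxE /=; ring. Qed.

Lemma add2_sqrs_gt0 a b : 0 < 2 + a ^+ 2 + b ^+ 2.
Proof. by rewrite -addrA ltr_pwDl// addr_ge0// sqr_ge0. Qed.

Lemma phi_izkm (x : 'cV[R]_3) (s : R := (Num.sqrt 2)^-1)
    (r : R := Num.sqrt (2 + x1 x ^+ 2 + x2 x ^+ 2)) :
  phi x = izkm (s * (r * cos (x3 x))) (s * (r * sin (x3 x)))
               (s * x1 x) (s * x2 x).
Proof.
rewrite /phi -/s -/r /matZ /matK /matM !mat2E.
by apply: eq_mat2; rewrite !mxE /=; ring.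
Qed.

Lemma inner_ge0 A : 0 <= inner A A.
Proof. by rewrite innerE -!expr2 !addr_ge0 ?sqr_ge0. Qed.

Lemma inner_eq0 A : inner A A = 0 -> A = 0.
Proof.
rewrite innerE -!expr2 => /eqP.
rewrite !paddr_eq0 ?addr_ge0 ?sqr_ge0// !sqrf_eq0.
move=> /andP[/andP[/andP[/eqP h1 /eqP h2] /eqP h3] /eqP h4].
by apply: eq_mat2; rewrite ?mxE.
Qed.

Lemma mnormK A : mnorm A ^+ 2 = inner A A.
Proof. by rewrite /mnorm sqr_sqrtr// inner_ge0. Qed.

(** Cauchy-Schwarz. *)
Lemma normr_inner_le A B : `|inner A B| <= mnorm A * mnorm B.
Proof.
rewrite -(@ler_pXn2r _ 2) ?nnegrE ?mulr_ge0 ?sqrtr_ge0//.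
rewrite exprMn !mnormK real_normK ?num_real// -subr_ge0.
(* Lagrange's identity *)
have -> : inner A A * inner B B - inner A B ^+ 2 =
    (A 0 0 * B 0 1 - A 0 1 * B 0 0) ^+ 2 + (A 0 0 * B 1 0 - A 1 0 * B 0 0) ^+ 2
  + (A 0 0 * B 1 1 - A 1 1 * B 0 0) ^+ 2 + (A 0 1 * B 1 0 - A 1 0 * B 0 1) ^+ 2
  + (A 0 1 * B 1 1 - A 1 1 * B 0 1) ^+ 2 + (A 1 0 * B 1 1 - A 1 1 * B 1 0) ^+ 2.
  by rewrite !innerE; ring.
by rewrite !addr_ge0 ?sqr_ge0.
Qed.

Lemma mnorm_cof A : mnorm (cof A) = mnorm A.
Proof.
by rewrite /mnorm; congr Num.sqrt; rewrite !innerE cofE !mxE /=; ring.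
Qed.

Lemma U_mat2 a : U a = mat2 (cos a) (- sin a) (sin a) (cos a).
Proof.
by rewrite /U /matZ !mat2E; apply: eq_mat2; rewrite !mxE /=; ring.
Qed.

(** Rotations commute with [I] and are reversed by [K]: the angles add up on the
    former and are subtracted on the latter. *)
Lemma U_diag_U a b r p :
  U a *m (r *: 1%:M + p *: matK) *m U b =
  izkm (r * cos (a + b)) (r * sin (a + b)) (p * cos (a - b)) (p * sin (a - b)).
Proof.
rewrite !U_mat2 /matK !mat2E cosD sinD cosB sinB.
by apply: eq_mat2; rewrite !mxE /=; ring.
Qed.

Lemma U_inv a : U a *m U (- a) = 1%:M.
Proof.
rewrite !U_mat2 cosN sinN !mat2E.
by apply: eq_mat2; rewrite !mxE /= -?(cos2Dsin2 a); ring.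
Qed.

Lemma tr_U a : (U a)^T = U (- a).
Proof. by rewrite !U_mat2 cosN sinN tr_mat2 opprK. Qed.

(** * Images of the disk *)

Lemma unit_diskE (v : 'cV[R]_2) :
  unit_disk v <-> v 0 0 ^+ 2 + v 1 0 ^+ 2 <= 1.
Proof. by rewrite /unit_disk /= mxE sum2E !mxE -!expr2. Qed.

Lemma unit_disk_U a (v : 'cV[R]_2) : unit_disk v -> unit_disk (U a *m v).
Proof.
have Ui := U_inv (- a); rewrite opprK in Ui.
by rewrite /unit_disk /= trmx_mul tr_U mulmxA -(mulmxA v^T) Ui mulmx1.
Qed.

Lemma fluid_domain_mulU A a : fluid_domain (A *m U a) = fluid_domain A.
Proof.
apply/seteqP; split=> _ [v vD <-].
- by exists (U a *m v); [exact: unit_disk_U|rewrite mulmxA].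
- exists (U (- a) *m v); first exact: unit_disk_U.
  by rewrite mulmxA -(mulmxA A) U_inv mulmx1.
Qed.

Lemma is_ellipseC (S : set 'cV[R]_2) a b : is_ellipse S a b -> is_ellipse S b a.
Proof.
move=> [a0 [b0 [c [e1 [e2 [e1e1 e2e2 e12 ->]]]]]]; split=> //; split=> //.
exists c, e2, e1; split=> //.
  by rewrite -e12 !mxE !sum2E !mxE; ring.
apply/seteqP; split=> v /= [x [y [xy ->]]]; exists y, x;
  by rewrite addrC addrAC.
Qed.

(** The second rotation is absorbed by the disk, and the columns of the first
    one are the directions of the axes. *)
Lemma is_ellipse_diag a b r p : 0 < r -> 0 < p ->
  is_ellipse (fluid_domain (U a *m mat2 r 0 0 p *m U b)) r p.
Proof.
move=> r0 p0.
have [rn pn] : r != 0 /\ p != 0 by rewrite !gt_eqF.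
rewrite fluid_domain_mulU; split=> //; split=> //.
exists 0, (col 0 (U a)), (col 1 (U a)).
have E (x y : R) :
    x *: col 0 (U a) + y *: col 1 (U a) = U a *m \col_i [:: x; y]`_i.
  by apply/colP; apply: ord2P; rewrite !mxE sum2E !mxE /=; ring.
split.
- by rewrite U_mat2 !mxE sum2E !mxE /= -(cos2Dsin2 a); ring.
- by rewrite U_mat2 !mxE sum2E !mxE /= -(cos2Dsin2 a); ring.
- by rewrite U_mat2 !mxE sum2E !mxE /=; ring.
apply/seteqP; split=> v /=.
- move=> [w /unit_diskE wD <-]; exists (r * w 0 0), (p * w 1 0); split.
    by rewrite !(mulrC _ (w _ _)) !mulfK ?gt_eqF.
  rewrite add0r E -mulmxA; congr (_ *m _).
  by apply/colP; apply: ord2P; rewrite !mxE sum2E !mxE /=; ring.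
- move=> [x [y [xy ->]]]; exists (\col_i [:: x / r; y / p]`_i).
    by apply/unit_diskE; rewrite !mxE.
  rewrite add0r E -mulmxA; congr (_ *m _).
  by apply/colP; apply: ord2P; rewrite !mxE sum2E !mxE /=;
    field; rewrite ?rn ?pn.
Qed.

End Algebra.

(** * Derivatives of curves *)

Section Calculus.
Variable R : realType.
Implicit Types (f g : R -> R) (t a b : R).

Lemma is_derive_mx m n (M : R -> 'M[R]_(m, n)) t (D : 'M[R]_(m, n)) :
  (forall i j, is_derive t 1 (fun u => M u i j) (D i j)) -> is_derive t 1 M D.
Proof.
move=> MD; have dM : derivable M t 1.
  by apply/derivable_mxP => i j; case: (MD i j).
apply: DeriveDef => //; rewrite derive_mx//; apply/matrixP => i j; rewrite mxE.
by case: (MD i j).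
Qed.

Lemma is_derive_coord m n (M : R -> 'M[R]_(m, n)) t (D : 'M[R]_(m, n)) i j :
  is_derive t 1 M D -> is_derive t 1 (fun u => M u i j) (D i j).
Proof.
move=> [dM <-]; rewrite derive_mx// mxE.
by apply/derivableP; move/derivable_mxP: dM.
Qed.

Lemma is_derive_continuous (V : normedModType R) (F DF : R -> V) :
  (forall t, is_derive t 1 F (DF t)) -> continuous F.
Proof.
move=> dF t; apply/differentiable_continuous/derivable1_diffP.
by case: (dF t).
Qed.

Lemma is_derive_derive1 (V : normedModType R) (F DF : R -> V) :
  (forall t, is_derive t 1 F (DF t)) -> derive1 F = DF.
Proof. by move=> dF; apply/funext => t; rewrite derive1E; case: (dF t). Qed.

Lemma derive1_is_derive (V : normedModType R) (F : R -> V) t :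
  derivable F t 1 -> is_derive t 1 F (derive1 F t).
Proof. by move=> dF; rewrite derive1E; apply/derivableP. Qed.

(* The rules of differentiation for functions displayed pointwise. Being terms
   with explicit premises, they combine into the derivative of a compound
   formula. *)

Lemma is_derive_sum2 f g t a b : is_derive t 1 f a -> is_derive t 1 g b ->
  is_derive t 1 (fun u => f u + g u) (a + b).
Proof. exact: is_deriveD. Qed.

Lemma is_derive_opp f t a : is_derive t 1 f a ->
  is_derive t 1 (fun u => - f u) (- a).
Proof. exact: is_deriveN. Qed.

Lemma is_derive_mul f g t a b : is_derive t 1 f a -> is_derive t 1 g b ->
  is_derive t 1 (fun u => f u * g u) (f t * b + g t * a).
Proof. exact: is_deriveM. Qed.

Lemma is_derive_sqr f t a : is_derive t 1 f a ->
  is_derive t 1 (fun u => f u ^+ 2) (2 * f t * a).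
Proof.
move=> df; apply: (is_derive_eq (is_derive_mul df df)); ring.
Qed.

Lemma is_derive_inv f t a : is_derive t 1 f a -> f t != 0 ->
  is_derive t 1 (fun u => (f u)^-1) (- (a / f t ^+ 2)).
Proof.
move=> df f0; apply: (is_derive_eq (is_deriveV f0 df)).
by rewrite scaleNr /GRing.scale /= mulrC.
Qed.

Lemma is_derive_comp1 f g t a b : is_derive (g t) 1 f a -> is_derive t 1 g b ->
  is_derive t 1 (fun u => f (g u)) (a * b).
Proof. exact: is_derive1_comp. Qed.

Lemma is_derive_cosf f t a : is_derive t 1 f a ->
  is_derive t 1 (fun u => cos (f u)) (- sin (f t) * a).
Proof. exact: is_derive_comp1. Qed.

Lemma is_derive_sinf f t a : is_derive t 1 f a ->
  is_derive t 1 (fun u => sin (f u)) (cos (f t) * a).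
Proof. exact: is_derive_comp1. Qed.

Lemma is_derive_sqrtf f t a : is_derive t 1 f a -> 0 < f t ->
  is_derive t 1 (fun u => Num.sqrt (f u)) (a / (2 * Num.sqrt (f t))).
Proof.
move=> df f0; rewrite mulrC; apply: is_derive_comp1 df.
exact: is_derive1_sqrt.
Qed.

Lemma is_derive_const (k t : R) : is_derive t 1 (fun _ : R => k) 0.
Proof. exact: is_derive_cst. Qed.

Lemma is_derive_var t : is_derive t 1 (fun u : R => u) 1.
Proof. exact: is_derive_id. Qed.

Lemma is_derive_izkm (a b c d : R -> R) t a' b' c' d' :
  is_derive t 1 a a' -> is_derive t 1 b b' ->
  is_derive t 1 c c' -> is_derive t 1 d d' ->
  is_derive t 1 (fun u => izkm (a u) (b u) (c u) (d u)) (izkm a' b' c' d').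
Proof.
move=> da db dc dd; apply: is_derive_mx; apply: ord2P; apply: ord2P;
  under eq_fun do rewrite mxE /=; rewrite mxE /=.
- exact: is_derive_sum2.
- by apply: is_derive_sum2 => //; exact: is_derive_opp.
- exact: is_derive_sum2.
- by apply: is_derive_sum2 => //; exact: is_derive_opp.
Qed.

(** The velocity of the curve [phi (x t)], in terms of that of [x]. *)
Lemma is_derive_phi (x : R -> 'cV[R]_3) t (y : 'cV[R]_3)
    (s : R := (Num.sqrt 2)^-1)
    (r : R := Num.sqrt (2 + x1 (x t) ^+ 2 + x2 (x t) ^+ 2))
    (r' : R := (x1 (x t) * x1 y + x2 (x t) * x2 y) / r) :
  is_derive t 1 x y ->
  is_derive t 1 (fun u => phi (x u))
    (izkm (s * (r' * cos (x3 (x t)) - r * sin (x3 (x t)) * x3 y))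
          (s * (r' * sin (x3 (x t)) + r * cos (x3 (x t)) * x3 y))
          (s * x1 y) (s * x2 y)).
Proof.
move=> dx; under eq_fun do rewrite phi_izkm.
have d1 : is_derive t 1 (fun u => x1 (x u)) (x1 y) by exact: is_derive_coord.
have d2 : is_derive t 1 (fun u => x2 (x u)) (x2 y) by exact: is_derive_coord.
have d3 : is_derive t 1 (fun u => x3 (x u)) (x3 y) by exact: is_derive_coord.
have r2 : 0 < 2 + x1 (x t) ^+ 2 + x2 (x t) ^+ 2.
  exact: add2_sqrs_gt0.
have rn0 : r != 0 by rewrite gt_eqF// sqrtr_gt0.
have dr : is_derive t 1
    (fun u => Num.sqrt (2 + x1 (x u) ^+ 2 + x2 (x u) ^+ 2)) r'.
  have dr2 := is_derive_sum2 (is_derive_sum2 (is_derive_const 2 t)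
    (is_derive_sqr d1)) (is_derive_sqr d2).
  by apply: (is_derive_eq (is_derive_sqrtf dr2 r2)); rewrite /r' -/r; field.
pose ds := is_derive_const s t.
have da := is_derive_mul ds (is_derive_mul dr (is_derive_cosf d3)).
have db := is_derive_mul ds (is_derive_mul dr (is_derive_sinf d3)).
have dc := is_derive_mul ds d1.
have dd := is_derive_mul ds d2.
apply: (is_derive_eq (is_derive_izkm da db dc dd)).
by congr izkm; rewrite -/r; ring.
Qed.

Lemma differentiable_phi (x : 'cV[R]_3) : differentiable (@phi R) x.
Proof.
have d1 : differentiable (@x1 R) x by exact: differentiable_coord.
have d2 : differentiable (@x2 R) x by exact: differentiable_coord.
have d3 : differentiable (@x3 R) x by exact: differentiable_coord.
have dr : differentiable
    (fun y : 'cV[R]_3 => Num.sqrt (2 + x1 y ^+ 2 + x2 y ^+ 2)) x.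
  apply: (@differentiable_comp _ _ _ _
    (fun y : 'cV[R]_3 => 2 + x1 y ^+ 2 + x2 y ^+ 2) (@Num.sqrt R)).
    exact: (differentiableD (differentiableD (differentiable_cst (2 : R) x)
      (differentiableX 1 d1)) (differentiableX 1 d2)).
  apply/derivable1_diffP; apply: ex_derive; apply: is_derive1_sqrt.
  exact: add2_sqrs_gt0.
have dc : differentiable (fun y : 'cV[R]_3 => cos (x3 y)) x.
  apply: (@differentiable_comp _ _ _ _ (@x3 R)) => //.
  exact/derivable1_diffP.
have ds : differentiable (fun y : 'cV[R]_3 => sin (x3 y)) x.
  apply: (@differentiable_comp _ _ _ _ (@x3 R)) => //.
  exact/derivable1_diffP.
pose r y : R := Num.sqrt (2 + x1 y ^+ 2 + x2 y ^+ 2).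
pose rI y := (r y * cos (x3 y)) *: (1%:M : 'M[R]_2).
pose rZ y := (r y * sin (x3 y)) *: (@matZ R).
have -> : @phi R = (Num.sqrt 2)^-1 *: (rI + rZ + (fun y => x1 y *: matK)
    + (fun y => x2 y *: matM)).
  apply/funext => y; rewrite /phi.
  by congr (_ *: (_ + _ + _)); rewrite scalerDr !scalerA.
apply: differentiableZ; apply: differentiableD; last exact: differentiableZl.
apply: differentiableD; last exact: differentiableZl.
by apply: differentiableD; apply: differentiableZl; apply: differentiableM.
Qed.

End Calculus.

(** * The metric in the chart *)

Section Metric.
Variable R : realType.
Implicit Types (x y v : 'cV[R]_3).

(** A directional derivative is the derivative along a line. *)
Lemma derive_line (V W : normedModType R) (F : V -> W) (x v : V) :
  'D_v F x = 'D_1 (fun h : R => F (h *: v + x)) 0.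
Proof.
rewrite /derive; set d1 := fun h => h^-1 *: _; set d2 := fun h => h^-1 *: _.
suff -> : d1 = d2 by [].
by apply/funext => h; rewrite /d1 /d2 /= addr0 scale0r add0r [h%:A]mulr1.
Qed.

(** The differential of [phi] is read off from the velocity of the curve
    [phi (x + h y)]. *)
Lemma DphiE x y (s : R := (Num.sqrt 2)^-1)
    (r : R := Num.sqrt (2 + x1 x ^+ 2 + x2 x ^+ 2))
    (r' : R := (x1 x * x1 y + x2 x * x2 y) / r) :
  Dphi x y = izkm (s * (r' * cos (x3 x) - r * sin (x3 x) * x3 y))
                  (s * (r' * sin (x3 x) + r * cos (x3 x) * x3 y))
                  (s * x1 y) (s * x2 y).
Proof.
rewrite /Dphi -deriveE; last exact: differentiable_phi.
have dl : is_derive (0 : R) 1 (fun h : R => h *: y + x) y.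
  apply: is_derive_mx => i j; under eq_fun do rewrite !mxE.
  have d0 := is_derive_mul (is_derive_var (0 : R)) (is_derive_const (y i j) 0).
  have dx := is_derive_const (x i j) 0.
  by apply: (is_derive_eq (is_derive_sum2 d0 dx)); ring.
rewrite derive_line.
have := is_derive_phi dl; rewrite scale0r add0r => dphi.
by rewrite derive_val.
Qed.

Lemma sqr_isqrt2 : (Num.sqrt 2 : R)^-1 ^+ 2 = 2^-1.
Proof. by rewrite exprVn sqr_sqrtr. Qed.

(** The metric induced by [phi] on the chart. *)
Lemma inner_Dphi x y v : inner (Dphi x y) (Dphi x v) =
  x1 y * x1 v + x2 y * x2 v
  + (x1 x * x1 y + x2 x * x2 y) * (x1 x * x1 v + x2 x * x2 v)
      / (2 + x1 x ^+ 2 + x2 x ^+ 2)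
  + (2 + x1 x ^+ 2 + x2 x ^+ 2) * (x3 y * x3 v).
Proof.
rewrite !DphiE inner_izkm.
set s := (Num.sqrt 2)^-1; set r := Num.sqrt (2 + _ + _).
have r2 : 2 + x1 x ^+ 2 + x2 x ^+ 2 = r ^+ 2.
  by rewrite sqr_sqrtr// ltW// add2_sqrs_gt0.
have rn0 : r != 0 by rewrite gt_eqF// sqrtr_gt0 add2_sqrs_gt0.
rewrite r2.
have s2 : 2 * (s * s) = 1 by rewrite -expr2 sqr_isqrt2 divff.
transitivity ((2 * (s * s)) * (x1 y * x1 v + x2 y * x2 v
    + (x1 x * x1 y + x2 x * x2 y) * (x1 x * x1 v + x2 x * x2 v) / r ^+ 2
      * (cos (x3 x) ^+ 2 + sin (x3 x) ^+ 2)
    + (cos (x3 x) ^+ 2 + sin (x3 x) ^+ 2) * r ^+ 2 * (x3 y * x3 v))).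
  by field.
by rewrite s2 cos2Dsin2; ring.
Qed.

Lemma dot_mxvec m n (A B : 'M[R]_(m, n)) :
  \sum_k mxvec A 0 k * mxvec B 0 k = \sum_i \sum_j A i j * B i j.
Proof.
rewrite (reindex _ (curry_mxvec_bij _ _)) /= pair_bigA /=.
by apply: eq_bigr => -[i j] _ /=; rewrite !mxvecE.
Qed.

Lemma gE x i j :
  g x i j = inner (Dphi x (delta_mx i 0)) (Dphi x (delta_mx j 0)).
Proof.
rewrite /g mxE.
under eq_bigr do rewrite mxE /Dphi_mx !mxE.
by rewrite dot_mxvec innerE sum2E !sum2E addrA.
Qed.

(** On the first two coordinates [g x] is the identity plus [x x^T / rr]; on the
    third one it is [rr]. *)
Lemma mul_g x v (rr : R := 2 + x1 x ^+ 2 + x2 x ^+ 2)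
    (w : R := x1 x * x1 v + x2 x * x2 v) :
  g x *m v = vec3 (x1 v + x1 x * w / rr) (x2 v + x2 x * w / rr) (rr * x3 v).
Proof.
have rn0 : rr != 0 by rewrite gt_eqF// add2_sqrs_gt0.
apply/colP; apply: ord3P; rewrite !mxE sum3E !gE !inner_Dphi -/rr /w;
  rewrite /x1 /x2 /x3 !mxE /=; field; exact: rn0.
Qed.

Lemma g_unit x : g x \in unitmx.
Proof.
rewrite -unitmx_tr -row_free_unit; apply: inj_row_free => v.
move/(congr1 trmx); rewrite trmx_mul trmxK trmx0 mul_g.
set rr : R := 2 + _ + _; set w : R := x1 x * _ + x2 x * _ => E.
have rr0 : 0 < rr by exact: add2_sqrs_gt0.
have rn0 : rr != 0 by rewrite gt_eqF.
have E1 : x1 v^T + x1 x * w / rr = 0 by move/colP/(_ 0): E; rewrite !mxE /=.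
have E2 : x2 v^T + x2 x * w / rr = 0 by move/colP/(_ 1): E; rewrite !mxE /=.
have E3 : rr * x3 v^T = 0 by move/colP/(_ 2): E; rewrite !mxE /=.
(* Contracting the first two equations with x gives
   w * (1 + (x1 ^ 2 + x2 ^ 2) / rr) = 0. *)
have w0 : w = 0.
  have wE : w * (rr + (x1 x ^+ 2 + x2 x ^+ 2)) = 0.
    transitivity (rr * (x1 x * (x1 v^T + x1 x * w / rr)
                      + x2 x * (x2 v^T + x2 x * w / rr))).
      by rewrite /w; field.
    by rewrite E1 E2 !(mulr0, addr0).
  move/eqP: wE; rewrite mulf_eq0 => /orP[/eqP//|].
  by rewrite gt_eqF// ltr_pwDl// addr_ge0 ?sqr_ge0.
move: E1 E2 E3; rewrite w0 !(mulr0, mul0r, addr0) => v1 v2 /eqP.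
rewrite mulf_eq0 (negbTE rn0) /= => /eqP v3.
apply/rowP; apply: ord3P; rewrite mxE; move: v1 v2 v3;
  by rewrite /x1 /x2 /x3 !mxE.
Qed.

Lemma invmx_g_mul x v p : g x *m v = p -> invmx (g x) *m p = v.
Proof. by move=> <-; rewrite mulKmx// g_unit. Qed.

End Metric.

(** * Uniqueness for the constrained equation *)

Section Gronwall.
Variable R : realType.
Implicit Types (E DE c : R -> R) (t : R).

(* The function E * exp (- C u), with C the maximum of c on [0, t], is
   nonincreasing on that interval. *)
Lemma gronwall_ge0 E DE c : (forall t, is_derive t 1 E (DE t)) ->
  (forall t, 0 <= E t) -> continuous c -> (forall t, DE t <= c t * E t) ->
  E 0 = 0 -> forall t, 0 <= t -> E t = 0.
Proof.
move=> dE E_ge0 c_cont DE_le E0 t t0.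
have [m _ mP] := EVT_max t0 (continuous_subspaceT c_cont).
pose f (u : R) := E u * expR (- (c m * u)).
have df (u : R) : is_derive u 1 f ((DE u - c m * E u) * expR (- (c m * u))).
  have d0 := is_derive_mul (is_derive_const (c m) u) (is_derive_var u).
  have d1 := is_derive_opp d0.
  have d2 := is_derive_comp1 (is_derive_expR _) d1.
  by apply: (is_derive_eq (is_derive_mul (dE u) d2)); ring.
have fle : f t <= f 0.
  apply: (@ler0_derive1_nincr _ f 0 t) => //.
  - move=> u /[!in_itv]/= /andP[u0 ut]; rewrite (is_derive_derive1 df).
    rewrite mulr_le0_ge0 ?expR_ge0// subr_le0 (le_trans (DE_le u))//.
    by rewrite ler_wpM2r// mP// in_itv/= !ltW.
  - exact/continuous_subspaceT/(is_derive_continuous df).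
move: fle; rewrite /f E0 mul0r pmulr_lle0 ?expR_gt0// => Ele.
by apply/eqP; rewrite eq_le Ele E_ge0.
Qed.

(** Gronwall's inequality on the whole line, for zero initial value. *)
Lemma gronwall E DE c : (forall t, is_derive t 1 E (DE t)) ->
  (forall t, 0 <= E t) -> continuous c -> (forall t, `|DE t| <= c t * E t) ->
  E 0 = 0 -> forall t, E t = 0.
Proof.
move=> dE E_ge0 c_cont DE_le E0 t; have [t0|t0] := leP 0 t.
  apply: (gronwall_ge0 dE E_ge0 c_cont) => // u.
  exact: le_trans (ler_norm _) (DE_le u).
rewrite -(opprK t).
apply: (@gronwall_ge0 (fun u => E (- u)) (fun u => - DE (- u))
  (fun u => c (- u))).
- move=> u; have du := is_derive_opp (is_derive_var u).
  by apply: (is_derive_eq (is_derive_comp1 (dE (- u)) du)); ring.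
- by move=> u; exact: E_ge0.
- by move=> u; apply: continuous_comp; [exact: continuousN|exact: c_cont].
- by move=> u; rewrite (le_trans (ler_norm _))// normrN DE_le.
- by rewrite oppr0.
- by rewrite oppr_ge0 ltW.
Qed.

End Gronwall.

Section Uniqueness.
Variable R : realType.
Implicit Types (A B X Y : 'M[R]_2) (P Q : R -> 'M[R]_2) (t : R).

Lemma is_derive_inner P Q t X Y : is_derive t 1 P X -> is_derive t 1 Q Y ->
  is_derive t 1 (fun u => inner (P u) (Q u)) (inner X (Q t) + inner (P t) Y).
Proof.
move=> dP dQ; under eq_fun do rewrite innerE.
have d i j := is_derive_mul (is_derive_coord i j dP) (is_derive_coord i j dQ).
apply: (is_derive_eq (is_derive_sum2 (is_derive_sum2 (is_derive_sum2
  (d 0 0) (d 0 1)) (d 1 0)) (d 1 1))).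
by rewrite !innerE; ring.
Qed.

Lemma is_derive_cof P t X : is_derive t 1 P X ->
  is_derive t 1 (fun u => cof (P u)) (cof X).
Proof.
move=> dP; apply: is_derive_mx; have d i j := is_derive_coord i j dP.
apply: ord2P; apply: ord2P; under eq_fun do rewrite cofE mxE /=;
  rewrite cofE mxE /=; do ?[exact: d]; exact: is_derive_opp.
Qed.

Lemma is_derive_add P Q t X Y : is_derive t 1 P X -> is_derive t 1 Q Y ->
  is_derive t 1 (fun u => P u + Q u) (X + Y).
Proof. exact: is_deriveD. Qed.

Lemma is_derive_sub P Q t X Y : is_derive t 1 P X -> is_derive t 1 Q Y ->
  is_derive t 1 (fun u => P u - Q u) (X - Y).
Proof. exact: is_deriveB. Qed.

Lemma continuous_mnorm (P P' : R -> 'M[R]_2) :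
  (forall t : R, is_derive t 1 P (P' t)) ->
  continuous (fun t => mnorm (P t)).
Proof.
move=> dP t.
have ci := is_derive_continuous (fun u => is_derive_inner (dP u) (dP u)).
exact: continuous_comp (ci t) (@sqrt_continuous R _).
Qed.

Lemma is_derive_cst_eq0 (f : R -> R) k t a :
  (forall u, f u = k) -> is_derive t 1 f a -> a = 0.
Proof.
move=> fk; have -> : f = fun=> k by apply/funext.
by move=> [_ <-]; apply: derive_val; exact: is_derive_const.
Qed.

Lemma innerDl A B X : inner (A + B) X = inner A X + inner B X.
Proof. by rewrite !innerE !mxE; ring. Qed.

Lemma innerZl k A X : inner (k *: A) X = k * inner A X.
Proof. by rewrite !innerE !mxE; ring. Qed.

Lemma innerC A B : inner A B = inner B A.
Proof. by rewrite !innerE; ring. Qed.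

Lemma inner_cof A : inner A (cof A) = 2 * \det A.
Proof. by rewrite innerE cofE det2E !mxE /=; ring. Qed.

Lemma inner_cofC A B : inner A (cof B) = inner B (cof A).
Proof. by rewrite !innerE !cofE !mxE /=; ring. Qed.

Lemma inner_cof_cof A B : inner (cof A) (cof B) = inner A B.
Proof. by rewrite !innerE !cofE !mxE /=; ring. Qed.

(** Along a motion in the group, differentiating [det A = 1] twice determines
    the Lagrange multiplier. *)
Lemma multiplierE (kappa : R) (lambda : R -> R) (P P' P'' : R -> 'M[R]_2) :
  (forall t : R, is_derive t 1 P (P' t)) ->
  (forall t : R, is_derive t 1 P' (P'' t)) ->
  (forall t, P'' t + kappa *: P t = lambda t *: cof (P t)) ->
  (forall t, \det (P t) = 1) ->
  forall t,
    lambda t * inner (P t) (P t) = 2 * kappa - inner (P' t) (cof (P' t)).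
Proof.
move=> dP dP' motP detP.
have tangent t : inner (P' t) (cof (P t)) = 0.
  have d := is_derive_inner (dP t) (is_derive_cof (dP t)).
  have det2 u : inner (P u) (cof (P u)) = 2 by rewrite inner_cof detP mulr1.
  have := is_derive_cst_eq0 det2 d; rewrite (inner_cofC (P t)) -mulr2n => /eqP.
  by rewrite mulrn_eq0 => /eqP.
move=> t.
have d := is_derive_inner (dP' t) (is_derive_cof (dP t)).
have := is_derive_cst_eq0 tangent d.
have -> : P'' t = lambda t *: cof (P t) + (- kappa) *: P t.
  by rewrite -motP scaleNr addrK.
rewrite innerDl !innerZl inner_cof_cof inner_cof detP => H; lra.
Qed.

(** Two motions with the same initial data agree: along them the acceleration
    is a Lipschitz function of position and velocity, with a constant that is
    continuous in time, so that Gronwall's inequality applies to the squared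
    distance of the motions in phase space. *)
Lemma SL2_motion_unique (kappa : R) (l1 l2 : R -> R)
    (P1 P1' P1'' P2 P2' P2'' : R -> 'M[R]_2) :
  (forall t : R, is_derive t 1 P1 (P1' t)) ->
  (forall t : R, is_derive t 1 P1' (P1'' t)) ->
  (forall t : R, is_derive t 1 P2 (P2' t)) ->
  (forall t : R, is_derive t 1 P2' (P2'' t)) ->
  (forall t, P1'' t + kappa *: P1 t = l1 t *: cof (P1 t)) ->
  (forall t, P2'' t + kappa *: P2 t = l2 t *: cof (P2 t)) ->
  (forall t, \det (P1 t) = 1) -> (forall t, \det (P2 t) = 1) ->
  continuous l1 -> continuous l2 -> P1 0 = P2 0 -> P1' 0 = P2' 0 ->
  P1 = P2.
Proof.
move=> d1 d1' d2 d2' eq1 eq2 det1 det2 c1 c2 P0 P0'.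
pose D t := P1 t - P2 t; pose G t := P1' t - P2' t.
have dD (t : R) : is_derive t 1 D (G t) by exact: is_derive_sub.
have dG (t : R) : is_derive t 1 G (P1'' t - P2'' t) by exact: is_derive_sub.
pose dl t := l1 t - l2 t.
have GE t : P1'' t - P2'' t =
    (- kappa) *: D t + l1 t *: cof (D t) + dl t *: cof (P2 t).
  have -> : P1'' t = l1 t *: cof (P1 t) - kappa *: P1 t by rewrite -eq1 addrK.
  have -> : P2'' t = l2 t *: cof (P2 t) - kappa *: P2 t by rewrite -eq2 addrK.
  by rewrite /dl /D !cofE; apply: eq_mat2; rewrite !mxE /=; ring.
(* Subtract the two expressions of the multipliers, and polarize the quadratic
   forms <A, A> and <B, cof B>. *)
have dlE t : dl t * inner (P1 t) (P1 t) =
    - l2 t * inner (D t) (P1 t + P2 t) - inner (G t) (cof (P1' t + P2' t)).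
  have L1 := multiplierE d1 d1' eq1 det1 t.
  have L2 := multiplierE d2 d2' eq2 det2 t.
  rewrite mulrBl L1.
  have -> : inner (P1 t) (P1 t) =
      inner (P2 t) (P2 t) + inner (D t) (P1 t + P2 t).
    by rewrite /D !innerE !mxE; ring.
  rewrite mulrDr L2 /G !innerE !cofE !mxE /=; ring.
(* By Cauchy-Schwarz, since <A, cof A> = 2 det A = 2 and |cof A| = |A|. *)
have norm_ge1 t : 1 <= inner (P1 t) (P1 t).
  have := le_trans (ler_norm _) (normr_inner_le (P1 t) (cof (P1 t))).
  rewrite inner_cof det1 mnorm_cof -expr2 mnormK mulr1; apply: le_trans.
  by rewrite ler1n.
pose m t := `|l2 t| * mnorm (P1 t + P2 t); pose n t := mnorm (P1' t + P2' t).
have dl_le t : `|dl t| <= m t * mnorm (D t) + n t * mnorm (G t).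
  apply: (@le_trans _ _ (`|dl t * inner (P1 t) (P1 t)|)).
    by rewrite normrM ler_peMr// (le_trans (norm_ge1 t))// ler_norm.
  rewrite dlE (le_trans (ler_normB _ _))// lerD//.
    rewrite normrM normrN /m -mulrA ler_wpM2l// mulrC.
    exact: normr_inner_le.
  by rewrite (le_trans (normr_inner_le _ _))// mnorm_cof mulrC.
pose E t := inner (D t) (D t) + inner (G t) (G t).
pose DE t := 2 * inner (D t) (G t) + 2 * inner (G t) (P1'' t - P2'' t).
have dE (t : R) : is_derive t 1 E (DE t).
  apply: (is_derive_eq (is_derive_sum2 (is_derive_inner (dD t) (dD t))
    (is_derive_inner (dG t) (dG t)))).
  by rewrite /DE (innerC (G t) (D t)) (innerC (P1'' t - P2'' t)); ring.
pose c t := 1 + `|kappa| + `|l1 t| + m t * mnorm (P2 t)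
  + 2 * (n t * mnorm (P2 t)).
have E_ge0 t : 0 <= E t by rewrite addr_ge0 ?inner_ge0.
have c_cont : continuous c.
  have cl1 : continuous (fun t => `|l1 t|).
    by move=> t; apply: continuous_comp; [exact: c1|exact: norm_continuous].
  have cl2 : continuous (fun t => `|l2 t|).
    by move=> t; apply: continuous_comp; [exact: c2|exact: norm_continuous].
  have cP2 := continuous_mnorm d2.
  have cS := continuous_mnorm (fun t => is_derive_add (d1 t) (d2 t)).
  have cS' := continuous_mnorm (fun t => is_derive_add (d1' t) (d2' t)).
  have cmm : continuous m by move=> t; exact: (cvgM (cl2 t) (cS t)).
  move=> t; rewrite /c; apply: cvgD; last first.
    by apply: cvgM; [exact: cvg_cst|apply: cvgM; [exact: cS'|exact: cP2]].
  apply: cvgD; last by apply: cvgM; [exact: cmm|exact: cP2].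
  by apply: cvgD; [exact: cvg_cst|exact: cl1].
have DE_le t : `|DE t| <= c t * E t.
  set d := mnorm (D t); set v := mnorm (G t); set p := mnorm (P2 t).
  have d0 : 0 <= d by exact: sqrtr_ge0.
  have v0 : 0 <= v by exact: sqrtr_ge0.
  have p0 : 0 <= p by exact: sqrtr_ge0.
  have m0 : 0 <= m t by rewrite mulr_ge0// sqrtr_ge0.
  have n0 : 0 <= n t by exact: sqrtr_ge0.
  have GG : `|inner (G t) (P1'' t - P2'' t)| <=
      `|kappa| * (v * d) + `|l1 t| * (v * d) + (m t * d + n t * v) * (v * p).
    rewrite GE innerC !innerDl !innerZl !(innerC _ (G t)).
    rewrite (le_trans (ler_normD _ _))// lerD//.
      rewrite (le_trans (ler_normD _ _))// lerD// normrM ?normrN ler_wpM2l//.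
        exact: normr_inner_le.
      by rewrite (le_trans (normr_inner_le _ _))// mnorm_cof.
    rewrite normrM ler_pM//.
    by rewrite (le_trans (normr_inner_le _ _))// mnorm_cof.
  apply: (@le_trans _ _ (2 * (d * v) + 2 * (`|kappa| * (v * d)
      + `|l1 t| * (v * d) + (m t * d + n t * v) * (v * p)))).
    rewrite /DE (le_trans (ler_normD _ _))// lerD// normrM ger0_norm//
      ler_wpM2l//.
    exact: normr_inner_le.
  rewrite /E -!mnormK -/d -/v /c -/p -subr_ge0.
  have -> : forall k l : R,
      (1 + k + l + m t * p + 2 * (n t * p)) * (d ^+ 2 + v ^+ 2)
      - (2 * (d * v) + 2 * (k * (v * d) + l * (v * d)
         + (m t * d + n t * v) * (v * p)))
      = (1 + k + l + m t * p) * (d - v) ^+ 2 + 2 * (n t * p * d ^+ 2).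
    by move=> *; ring.
  by do ?[by []|exact: sqr_ge0|apply: addr_ge0|apply: mulr_ge0].
have E_eq0 := gronwall dE E_ge0 c_cont DE_le.
have E0 : E 0 = 0.
  by rewrite /E /D /G P0 P0' !subrr innerE !mxE; ring.
apply/funext => t; apply/eqP; rewrite -subr_eq0; apply/eqP/inner_eq0/eqP.
have /eqP := E_eq0 E0 t.
by rewrite paddr_eq0 ?inner_ge0// => /andP[].
Qed.

Lemma SL2_solution_unique (kappa : R) A0 B0 (P1 P2 : R -> 'M[R]_2) :
  SL2_solution kappa A0 B0 P1 -> SL2_solution kappa A0 B0 P2 -> P1 = P2.
Proof.
move=> [[_ det1] [d1 [d1' _]] [l1 [c1 eq1]] P10 P10'].
move=> [[_ det2] [d2 [d2' _]] [l2 [c2 eq2]] P20 P20'].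
have P0 : P1 0 = P2 0 by rewrite P10 P20.
have P0' : derive1 P1 0 = derive1 P2 0 by rewrite P10' P20'.
exact: (SL2_motion_unique (fun t => derive1_is_derive (d1 t))
  (fun t => derive1_is_derive (d1' t)) (fun t => derive1_is_derive (d2 t))
  (fun t => derive1_is_derive (d2' t)) eq1 eq2 det1 det2 c1 c2 P0 P0').
Qed.

End Uniqueness.

(** * The motion defined by the reduced system *)

Section Motion.
Variable R : realType.
Implicit Types (p k th : R -> R) (t L c kappa : R).

(** The radius of the chart along a motion with first reduced coordinate [p]. *)
Definition radius (p : R -> R) (t : R) : R := Num.sqrt (2 + p t ^+ 2).

(** The right-hand side of the reduced equation for [q1], where [p] stands for
    [q1] and [k] for [xi1]. *)
Definition speed (p k : R -> R) (t : R) : R :=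
  (2 + p t ^+ 2) * k t / (2 * (1 + p t ^+ 2)).

(** The Lagrange multiplier in reduced coordinates, [L] being the conserved
    momentum [xi3]. *)
Definition multiplier (kappa L : R) (p k : R -> R) (t : R) : R :=
  (speed p k t ^+ 2 - L ^+ 2 / 2) / ((2 + p t ^+ 2) * (1 + p t ^+ 2))
  + kappa / (1 + p t ^+ 2).

(** The motion with reduced coordinates [q1 = p], [q2 = c] and [q3 = th]. *)
Definition motion (c : R) (p th : R -> R) (t : R) : 'M[R]_2 :=
  (Num.sqrt 2)^-1 *: izkm (radius p t * cos (th t)) (radius p t * sin (th t))
                          (p t * cos c) (p t * sin c).

(** The velocity of that motion, for the angular velocity
    [th' = L / radius ^ 2]. *)
Definition motion_velocity (c L : R) (p k th : R -> R) (t : R) : 'M[R]_2 :=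
  (Num.sqrt 2)^-1 *: izkm
    (p t * speed p k t / radius p t * cos (th t) - L / radius p t * sin (th t))
    (p t * speed p k t / radius p t * sin (th t) + L / radius p t * cos (th t))
    (speed p k t * cos c) (speed p k t * sin c).

Lemma radius_gt0 p t : 0 < radius p t.
Proof. by rewrite sqrtr_gt0 ltr_pwDl// sqr_ge0. Qed.

Lemma radius_neq0 p t : radius p t != 0.
Proof. by rewrite gt_eqF// radius_gt0. Qed.

Lemma sqr_radius p t : radius p t ^+ 2 = 2 + p t ^+ 2.
Proof. by rewrite sqr_sqrtr// addr_ge0// sqr_ge0. Qed.

Lemma add1_sqr_neq0 (a : R) : 1 + a ^+ 2 != 0.
Proof. by rewrite gt_eqF// ltr_pwDl// sqr_ge0. Qed.

Lemma add2_sqr_neq0 (a : R) : 2 + a ^+ 2 != 0.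
Proof. by rewrite gt_eqF// ltr_pwDl// sqr_ge0. Qed.

Lemma scale_izkm (s a b d e : R) :
  s *: izkm a b d e = izkm (s * a) (s * b) (s * d) (s * e).
Proof. by rewrite /izkm scale_mat2; apply: eq_mat2; rewrite !mxE /=; ring. Qed.

Lemma sub_izkm (a b d e a' b' d' e' : R) : izkm a b d e - izkm a' b' d' e' =
  izkm (a - a') (b - b') (d - d') (e - e').
Proof. by apply: eq_mat2; rewrite !mxE /=; ring. Qed.

Lemma is_derive_scale (s : R) (P : R -> 'M[R]_2) t (X : 'M[R]_2) :
  is_derive t 1 P X -> is_derive t 1 (fun u => s *: P u) (s *: X).
Proof. exact: is_deriveZ. Qed.

Variables (kappa L c : R) (p k th : R -> R).
Hypothesis dp : forall t, is_derive t 1 p (speed p k t).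
Hypothesis dk : forall t, is_derive t 1 k
  ((k t ^+ 2 / (2 * (1 + p t ^+ 2) ^+ 2) + L ^+ 2 / (2 + p t ^+ 2) ^+ 2
    - 2 * kappa) * p t).
Hypothesis dth : forall t, is_derive t 1 th (L / (2 + p t ^+ 2)).

Lemma is_derive_radius t :
  is_derive t 1 (radius p) (p t * speed p k t / radius p t).
Proof.
have d := is_derive_sum2 (is_derive_const 2 t) (is_derive_sqr (dp t)).
have r2 : 0 < 2 + p t ^+ 2 by rewrite ltr_pwDl// sqr_ge0.
apply: (is_derive_eq (is_derive_sqrtf d r2)).
rewrite -/(radius p t); field; exact: radius_neq0.
Qed.

Lemma is_derive_speed t :
  is_derive t 1 (speed p k) (- (multiplier kappa L p k t + kappa) * p t).
Proof.
have d1 := is_derive_sum2 (is_derive_const 1 t) (is_derive_sqr (dp t)).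
have d2 := is_derive_sum2 (is_derive_const 2 t) (is_derive_sqr (dp t)).
have d3 := is_derive_mul (is_derive_const 2 t) d1.
have n1 := add1_sqr_neq0 (p t); have n2 := add2_sqr_neq0 (p t).
have n3 : 2 * (1 + p t ^+ 2) != 0 by rewrite mulf_neq0.
apply: (is_derive_eq
  (is_derive_mul (is_derive_mul d2 (dk t)) (is_derive_inv d3 n3))).
by rewrite /multiplier /speed; field; rewrite n1 n2.
Qed.

(** The radial equation of motion, with the centrifugal term
    [L ^ 2 / radius ^ 3].  The relation [radius ^ 2 = 2 + p ^ 2] makes it
    compatible with the multiplier, which is chosen for the equation of [p]. *)
Lemma is_derive_radial_speed t :
  is_derive t 1 (fun u => p u * speed p k u / radius p u)
    ((multiplier kappa L p k t - kappa) * radius p t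
     + L ^+ 2 / radius p t ^+ 3).
Proof.
have rn := radius_neq0 p t; have r2 := sqr_radius p t.
have n1 := add1_sqr_neq0 (p t).
apply: (is_derive_eq (is_derive_mul (is_derive_mul (dp t) (is_derive_speed t))
  (is_derive_inv (is_derive_radius t) rn))).
set P := speed p k t; set r := radius p t; set l := multiplier kappa L p k t.
have p2 : p t ^+ 2 = r ^+ 2 - 2 by rewrite r2; ring.
have lE : l = (P ^+ 2 - L ^+ 2 / 2) / (r ^+ 2 * (r ^+ 2 - 1))
              + kappa / (r ^+ 2 - 1).
  rewrite /l /multiplier -/P -r2.
  by have -> : 1 + p t ^+ 2 = r ^+ 2 - 1 by rewrite p2; ring.
have n1' : r ^+ 2 - 1 != 0 by rewrite r2 addrAC (_ : 2 - 1 = 1) //; ring.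
transitivity (- (P ^+ 2 * p t ^+ 2) / r ^+ 3
              + (P ^+ 2 - (l + kappa) * p t ^+ 2) / r); first by field.
by rewrite p2 lE; field; rewrite rn.
Qed.

Lemma is_derive_angle t : is_derive t 1 th (L / radius p t ^+ 2).
Proof. by rewrite sqr_radius. Qed.

Lemma is_derive_motion t :
  is_derive t 1 (motion c p th) (motion_velocity c L p k th t).
Proof.
have rn := radius_neq0 p t.
have dr := is_derive_radius t; have da := is_derive_angle t.
have d1 := is_derive_mul dr (is_derive_cosf da).
have d2 := is_derive_mul dr (is_derive_sinf da).
have d3 := is_derive_mul (dp t) (is_derive_const (cos c) t).
have d4 := is_derive_mul (dp t) (is_derive_const (sin c) t).
apply: (is_derive_eq (is_derive_scale _ (is_derive_izkm d1 d2 d3 d4))).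
by rewrite /motion_velocity; congr (_ *: izkm _ _ _ _); field.
Qed.

Lemma is_derive_motion_velocity t :
  is_derive t 1 (motion_velocity c L p k th)
    (multiplier kappa L p k t *: cof (motion c p th t)
     - kappa *: motion c p th t).
Proof.
have rn := radius_neq0 p t.
have dr := is_derive_radius t; have da := is_derive_angle t.
have ds := is_derive_radial_speed t.
have dL := is_derive_mul (is_derive_const L t) (is_derive_inv dr rn).
have d1 := is_derive_sum2 (is_derive_mul ds (is_derive_cosf da))
  (is_derive_opp (is_derive_mul dL (is_derive_sinf da))).
have d2 := is_derive_sum2 (is_derive_mul ds (is_derive_sinf da))
  (is_derive_mul dL (is_derive_cosf da)).
have d3 := is_derive_mul (is_derive_speed t) (is_derive_const (cos c) t).
have d4 := is_derive_mul (is_derive_speed t) (is_derive_const (sin c) t).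
apply: (is_derive_eq (is_derive_scale _ (is_derive_izkm d1 d2 d3 d4))).
rewrite /motion !scale_izkm cof_izkm scale_izkm sub_izkm.
by move: (Num.sqrt 2)^-1 => s; congr izkm; field.
Qed.

Lemma continuous_multiplier : continuous (multiplier kappa L p k).
Proof.
have dw t := is_derive_sum2 (is_derive_const 1 t) (is_derive_sqr (dp t)).
have dr t := is_derive_sum2 (is_derive_const 2 t) (is_derive_sqr (dp t)).
have n1 t := add1_sqr_neq0 (p t).
have n2 t : (2 + p t ^+ 2) * (1 + p t ^+ 2) != 0.
  by rewrite mulf_neq0// add2_sqr_neq0.
exact: (is_derive_continuous (fun t => is_derive_sum2
  (is_derive_mul (is_derive_sum2 (is_derive_sqr (is_derive_speed t))
     (is_derive_const (- (L ^+ 2 / 2)) t))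
   (is_derive_inv (is_derive_mul (dr t) (dw t)) (n2 t)))
  (is_derive_mul (is_derive_const kappa t) (is_derive_inv (dw t) (n1 t))))).
Qed.

Lemma det_motion t : \det (motion c p th t) = 1.
Proof.
rewrite /motion scale_izkm det_izkm.
transitivity ((Num.sqrt 2)^-1 ^+ 2 *
  (radius p t ^+ 2 * (cos (th t) ^+ 2 + sin (th t) ^+ 2)
   - p t ^+ 2 * (cos c ^+ 2 + sin c ^+ 2))); first by ring.
by rewrite !cos2Dsin2 sqr_isqrt2 sqr_radius; field.
Qed.

Lemma inner_motion t :
  inner (motion c p th t) (motion c p th t) = 2 * (1 + p t ^+ 2).
Proof.
rewrite /motion scale_izkm inner_izkm.
transitivity (2 * (Num.sqrt 2)^-1 ^+ 2 *
  (radius p t ^+ 2 * (cos (th t) ^+ 2 + sin (th t) ^+ 2)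
   + p t ^+ 2 * (cos c ^+ 2 + sin c ^+ 2))); first by ring.
by rewrite !cos2Dsin2 sqr_isqrt2 sqr_radius; field.
Qed.

Lemma SL2_solution_motion :
  SL2_solution kappa (motion c p th 0) (motion_velocity c L p k th 0)
    (motion c p th).
Proof.
have dA := is_derive_motion; have dV := is_derive_motion_velocity.
have cA := is_derive_continuous dA.
have cW : continuous (fun t => multiplier kappa L p k t *: cof (motion c p th t)
     - kappa *: motion c p th t).
  move=> t; apply: cvgB.
    apply: cvgZ; first exact: continuous_multiplier.
    exact: is_derive_continuous (fun u => is_derive_cof (dA u)) t.
  by apply: cvgZ; [exact: cvg_cst|exact: cA].
split.
- by split=> // t; exact: det_motion.
- split=> [t|]; first by case: (dA t).
  rewrite (is_derive_derive1 dA); split=> [t|]; first by case: (dV t).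
  by rewrite (is_derive_derive1 dV).
- exists (multiplier kappa L p k); split; first exact: continuous_multiplier.
  by move=> t; rewrite (is_derive_derive1 dA) (is_derive_derive1 dV) subrK.
- by [].
- by rewrite (is_derive_derive1 dA).
Qed.

End Motion.

(** * From the reduced system to the matrix equation *)

Section Reduction.
Variable R : realType.

Lemma x1_vec3 (a b c : R) : x1 (vec3 a b c) = a.
Proof. by rewrite /x1 mxE. Qed.

Lemma x2_vec3 (a b c : R) : x2 (vec3 a b c) = b.
Proof. by rewrite /x2 mxE. Qed.

Lemma x3_vec3 (a b c : R) : x3 (vec3 a b c) = c.
Proof. by rewrite /x3 mxE. Qed.

Definition vec3E := (x1_vec3, x2_vec3, x3_vec3).

Lemma sqr_radius_psi (q : 'cV[R]_3) :
  2 + x1 (psi q) ^+ 2 + x2 (psi q) ^+ 2 = 2 + x1 q ^+ 2.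
Proof.
by rewrite /psi !vec3E -addrA !exprMn -mulrDr cos2Dsin2 mulr1.
Qed.

Lemma phi_psi (q : 'cV[R]_3) (r : R := Num.sqrt (2 + x1 q ^+ 2)) :
  phi (psi q) = (Num.sqrt 2)^-1 *: izkm (r * cos (x3 q)) (r * sin (x3 q))
     (x1 q * cos (x2 q)) (x1 q * sin (x2 q)).
Proof. by rewrite phi_izkm scale_izkm sqr_radius_psi /psi !vec3E. Qed.

(** For [xi2 = q2], the inverse Legendre transform takes the momentum [psi xi]
    to the velocity prescribed by the reduced system.  Only the values at one time
    matter, hence the constant functions. *)
Lemma Dphi_invmx_g (q xi : 'cV[R]_3) (p := fun _ : R => x1 q)
    (k := fun _ : R => x1 xi) (th := fun _ : R => x3 q) :
  x2 q = x2 xi ->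
  Dphi (psi q) (invmx (g (psi q)) *m psi xi) =
  motion_velocity (x2 q) (x3 xi) p k th 0.
Proof.
move=> q2.
set P := speed p k 0.
pose v := vec3 (P * cos (x2 q)) (P * sin (x2 q)) (x3 xi / (2 + x1 q ^+ 2)).
have wE : x1 (psi q) * x1 v + x2 (psi q) * x2 v = x1 q * P.
  transitivity (x1 q * P * (cos (x2 q) ^+ 2 + sin (x2 q) ^+ 2)).
    by rewrite /v /psi !vec3E; ring.
  by rewrite cos2Dsin2 mulr1.
have n1 := add1_sqr_neq0 (x1 q); have n2 := add2_sqr_neq0 (x1 q).
rewrite (@invmx_g_mul _ _ v); last first.
  rewrite mul_g wE sqr_radius_psi /v /psi !vec3E /P /speed /p /k -q2.
  by congr vec3; field; rewrite ?n1 ?n2.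
rewrite DphiE wE sqr_radius_psi /v /psi !vec3E /motion_velocity scale_izkm.
have r2 := sqr_radius p 0; have rn := radius_neq0 p 0.
rewrite -[in LHS]/(radius p 0) -/P -r2 -/(p 0) -/(th 0).
by move: (Num.sqrt 2)^-1 => s; congr izkm; rewrite ?q2; field.
Qed.

Lemma is_derive_col3 (v : R -> 'cV[R]_3) (t : R) (d : 'cV[R]_3) :
  is_derive t 1 v d ->
  [/\ is_derive t 1 (fun u => x1 (v u)) (x1 d),
      is_derive t 1 (fun u => x2 (v u)) (x2 d)
    & is_derive t 1 (fun u => x3 (v u)) (x3 d)].
Proof. by move=> dv; split; exact: is_derive_coord. Qed.

Lemma is_ellipse_motion (c : R) (p th : R -> R) (t : R)
    (N := mnorm (motion c p th t)) :
  is_ellipse (fluid_domain (motion c p th t))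
    ((Num.sqrt 2)^-1
     * (Num.sqrt (2^-1 * N ^+ 2 + 1) + Num.sqrt (2^-1 * N ^+ 2 - 1)))
    ((Num.sqrt 2)^-1
     * (Num.sqrt (2^-1 * N ^+ 2 + 1) - Num.sqrt (2^-1 * N ^+ 2 - 1))).
Proof.
have -> : 2^-1 * N ^+ 2 = 1 + p t ^+ 2 by rewrite mnormK inner_motion; field.
have -> : Num.sqrt (1 + p t ^+ 2 + 1) = radius p t.
  by congr Num.sqrt; ring.
have -> : Num.sqrt (1 + p t ^+ 2 - 1) = `|p t|.
  by rewrite -sqrtr_sqr; congr Num.sqrt; ring.
set s := (Num.sqrt 2)^-1.
have s0 : 0 < s by rewrite invr_gt0 sqrtr_gt0.
have pr : `|p t| < radius p t.
  rewrite -(@ltr_pXn2r _ 2) ?nnegrE ?normr_ge0 ?sqrtr_ge0//.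
  by rewrite real_normK ?num_real// sqr_radius ltrDr.
move: pr; rewrite ltr_norml => /andP[pr1 pr2].
have a0 : 0 < s * (radius p t + p t).
  by rewrite mulr_gt0//; lra.
have b0 : 0 < s * (radius p t - p t).
  by rewrite mulr_gt0// subr_gt0.
have -> : motion c p th t = U (2^-1 * (th t + c))
    *m mat2 (s * (radius p t + p t)) 0 0 (s * (radius p t - p t))
    *m U (2^-1 * (th t - c)).
  have -> : mat2 (s * (radius p t + p t)) 0 0 (s * (radius p t - p t)) =
      s *: (radius p t *: 1%:M + p t *: matK).
    by rewrite /matK !mat2E; apply: eq_mat2; rewrite !mxE /=; ring.
  rewrite -scalemxAr -scalemxAl U_diag_U.
  have -> : 2^-1 * (th t + c) + 2^-1 * (th t - c) = th t by field.
  by have -> : 2^-1 * (th t + c) - 2^-1 * (th t - c) = c by field.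
have := is_ellipse_diag (2^-1 * (th t + c)) (2^-1 * (th t - c)) a0 b0.
have [p0|p0] := leP 0 (p t); first by rewrite ger0_norm.
by rewrite ltr0_norm// opprK => /is_ellipseC.
Qed.

End Reduction.

Theorem theorem8p5 (R : realType) (kappa : R) (hkappa : 0 <= kappa)
    (A0 B0 : 'M[R]_2) (hD : tangent_bundle (A0, B0)) (hX2 : X2 A0 B0 = 0)
    (q xi : R -> 'cV[R]_3) (hq2 : x2 (q 0) = x2 (xi 0))
    (hinit : Phi (Gamma (Psi0 (q 0, xi 0))) = (A0, B0))
    (hsol : reduced_solution kappa q xi) :
  let A := fun t : R => phi (psi (q t)) in
  let rho := fun t : R => Num.sqrt (2 + x1 (q t) ^+ 2) in
  [/\ SL2_solution kappa A0 B0 A,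
      forall A' : R -> 'M[R]_2, SL2_solution kappa A0 B0 A' -> A' = A,
      forall t, A t =
        (Num.sqrt 2)^-1 *:
          (U (2^-1 * (x3 (q t) + x2 (q 0)))
           *m (rho t *: 1%:M + x1 (q t) *: matK)
           *m U (2^-1 * (x3 (q t) - x2 (q 0)))),
      forall t, 2^-1 * mnorm (A t) ^+ 2 = 1 + x1 (q t) ^+ 2
    & forall t, is_ellipse (fluid_domain (A t))
        ((Num.sqrt 2)^-1 * (Num.sqrt (2^-1 * mnorm (A t) ^+ 2 + 1)
                            + Num.sqrt (2^-1 * mnorm (A t) ^+ 2 - 1)))
        ((Num.sqrt 2)^-1 * (Num.sqrt (2^-1 * mnorm (A t) ^+ 2 + 1)
                            - Num.sqrt (2^-1 * mnorm (A t) ^+ 2 - 1)))].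
Proof.
move=> A rho.
case: hsol => [[dq _] [dxi _] q' xi'].
have dq1 t := is_derive_col3 (derive1_is_derive (dq t)).
have dxi1 t := is_derive_col3 (derive1_is_derive (dxi t)).
(* The angle q2 and the momentum xi3 are conserved. *)
have q2_cst t : x2 (q t) = x2 (q 0).
  apply: (is_derive_0_is_cst (f := fun u => x2 (q u))) => u.
  by have [_ d _] := dq1 u; move: d; rewrite q' vec3E.
have xi3_cst t : x3 (xi t) = x3 (xi 0).
  apply: (is_derive_0_is_cst (f := fun u => x3 (xi u))) => u.
  by have [_ _ d] := dxi1 u; move: d; rewrite xi' vec3E.
pose p t := x1 (q t); pose k t := x1 (xi t); pose th t := x3 (q t).
pose c := x2 (q 0); pose L := x3 (xi 0).
have dp (t : R) : is_derive t 1 p (speed p k t).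
  by have [d _ _] := dq1 t; move: d; rewrite q' vec3E.
have dk (t : R) : is_derive t 1 k
    ((k t ^+ 2 / (2 * (1 + p t ^+ 2) ^+ 2) + L ^+ 2 / (2 + p t ^+ 2) ^+ 2
      - 2 * kappa) * p t).
  by have [d _ _] := dxi1 t; move: d; rewrite xi' vec3E xi3_cst.
have dth (t : R) : is_derive t 1 th (L / (2 + p t ^+ 2)).
  by have [_ _ d] := dq1 t; move: d; rewrite q' vec3E xi3_cst.
have AE : A = motion c p th.
  by apply/funext => t; rewrite /A phi_psi q2_cst.
have solA : SL2_solution kappa A0 B0 A.
  have := SL2_solution_motion c dp dk dth; rewrite -AE.
  have -> : A 0 = A0 by rewrite /A -[RHS]/((A0, B0).1) -hinit.
  have -> // : motion_velocity c L p k th 0 = B0.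
  by rewrite -[RHS]/((A0, B0).2) -hinit /= Dphi_invmx_g.
split=> [//|A' solA'|t|t|t].
- exact: SL2_solution_unique solA' solA.
- rewrite AE U_diag_U /motion.
  have -> : 2^-1 * (x3 (q t) + x2 (q 0)) + 2^-1 * (x3 (q t) - x2 (q 0)) = th t.
    by rewrite /th; field.
  have -> // : 2^-1 * (x3 (q t) + x2 (q 0)) - 2^-1 * (x3 (q t) - x2 (q 0)) = c.
  by rewrite /c; field.
- by rewrite AE mnormK inner_motion mulKf.
- by rewrite AE; exact: is_ellipse_motion.
Qed.
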